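(* For every integer $n\ge 3$, $$\log_2 n - 2\log_2(\log_2 n) \le \mathrm{DOM}_t(K_n) \le \log_2 n - \log_2(\log_2 n) + 4.$$
   Context: An orientation of a (finite simple) graph $G$ is a digraph obtained by directing each edge $uv$ of $G$ in exactly one of the two directions $(u,v)$ or $(v,u)$. The orientation is valid if every vertex has in-degree at least $1$. A set $S\subseteq V(D)$ is a total dominating set of a digraph $D$ if every vertex of $D$ (including those in $S$) has an in-neighbor in $S$; $\gamma_t(D)$ is the minimum cardinality of a total dominating set of $D$. For a graph $G$ in which every component contains a cycle (equivalently, $G$ has a valid orientation), $\mathrm{DOM}_t(G)$ is the maximum of $\gamma_t(D)$ over all valid orientations $D$ of $G$. $K_n$ is the complete graph on $n$ vertices. *)

(* Defs.v *)
From HB Require Import structures.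
From mathcomp Require Import all_boot all_order all_algebra.
From mathcomp Require Import all_classical all_reals exp.

Set Implicit Arguments.
Unset Strict Implicit.
Unset Printing Implicit Defensive.

Import Order.TTheory GRing.Theory Num.Theory.

Record sgraph (V : finType) := SGraph {
  adj :> rel V;
  adj_sym : symmetric adj;
  adj_irrefl : irreflexive adj
}.

Lemma complete_sym (V : finType) : symmetric (fun u v : V => u != v).
Proof. by move=> u v; rewrite eq_sym. Qed.

Lemma complete_irrefl (V : finType) : irreflexive (fun u v : V => u != v).
Proof. by move=> u; rewrite eqxx. Qed.

Definition complete_graph (n : nat) : sgraph 'I_n :=
  SGraph (@complete_sym 'I_n) (@complete_irrefl 'I_n).

(* A digraph on V is its set of arcs; the arc (u, v) goes from u to v. *)
Notation digraph V := {set V * V}.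

(* Here (+) is exclusive or. *)
Definition orientation (V : finType) (G : sgraph V) (D : digraph V) : bool :=
  [forall u, forall v,
     if G u v then ((u, v) \in D) (+) ((v, u) \in D) else (u, v) \notin D].

Definition indegree (V : finType) (D : digraph V) (v : V) : nat :=
  #|[set u | (u, v) \in D]|.

Definition valid_orientation (V : finType) (G : sgraph V) (D : digraph V) :
    bool :=
  orientation G D && [forall v, 1 <= indegree D v].

Definition total_dominating (V : finType) (D : digraph V) (S : {set V}) :
    bool :=
  [forall v, exists u, (u \in S) && ((u, v) \in D)].

(* If every in-degree is at least 1 then setT is total dominating, so the
   minimum is over a nonempty family; the value for other D is irrelevant. *)
Definition gamma_t (V : finType) (D : digraph V) : nat :=
  #|[arg min_(S < [set: V] | total_dominating D S) #|S| ]|.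

(* Meaningful when G has a valid orientation, i.e. when every component of G
   contains a cycle; it is 0 otherwise. *)
Definition DOM_t (V : finType) (G : sgraph V) : nat :=
  \max_(D : digraph V | valid_orientation G D) gamma_t D.

Definition log2 (R : realType) (x : R) : R := (ln x / ln 2)%R.

(* Main.v *)
Require Import Defs.
From mathcomp Require Import all_boot all_order all_algebra.
From mathcomp Require Import all_classical all_reals exp.
From mathcomp Require Import unstable sequences zify ring lra.

Set Implicit Arguments.
Unset Strict Implicit.
Unset Printing Implicit Defensive.

(** Write L for log2 n. An orientation of the complete graph is a tournament,
    and in a tournament total domination is governed by Schutte's property
    S_k: every set of at most k vertices has a common in-neighbour. Such an
    in-neighbour has no in-neighbour inside the set, so S_k forbids total
    dominating sets of size k. Conversely a k-set without a common in-neighbour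
    dominates every vertex outside it, and all but at most one of its own
    vertices, so one more vertex makes it totally dominating.

    Upper bound. E. and G. Szekeres showed that a tournament with S_k has at
    least (k + 2) 2^(k-1) - 1 vertices ([schutte_order]). Any set of fewer than
    k vertices has more than k common in-neighbours: otherwise some v would
    dominate all of them, and adding v to the set would leave it without a
    common in-neighbour. Starting from the empty set, adding a suitable vertex
    more than halves the number of common in-neighbours each time, because some
    vertex of any tournament is dominated by less than half of it. Hence
    DOM_t (K_n) <= k + 1 as soon as n + 1 < (k + 2) 2^(k-1)
    ([DOM_t_complete_le]), and k = floor (L - log2 L + 3) satisfies this.

    Lower bound. In a random tournament a fixed k-set has no common in-neighbour
    outside it with probability (1 - 2^-k)^(n-k), so
    C(n, k) (1 - 2^-k)^(n-k) < 1 yields a tournament with S_k, whence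
    k < DOM_t (K_n) ([lt_DOM_t_complete_bin]). If m = DOM_t (K_n) were smaller
    than L - 2 log2 L, that is 2^m L^2 < n, the estimates C(n, m) <= n^m and
    1 - x <= exp (-x) would put k = m in this range, a contradiction. The trivial
    bound m >= 3 gives L > 3 and settles all small n at once. *)

(** * Tournaments and Schutte's property *)

Section Tournaments.
Variable V : finType.
Implicit Types (e : rel V) (A S W : {set V}).

(** This single equation gives irreflexivity (take u = v) as well as exactly one
    arc between two distinct vertices. *)
Definition tournament e := forall u v, e u v = (u != v) && ~~ e v u.

Definition common_in e A : {set V} := [set w | [forall a in A, e w a]].

(** With sets of size exactly k the property would be vacuous for k larger than
    the number of vertices. *)
Definition schutte e k := forall S, #|S| <= k -> common_in e S != finset.set0.

Lemma in_common e A w : reflect {in A, forall a, e w a} (w \in common_in e A).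
Proof. by rewrite inE; apply: forall_inP. Qed.

Lemma common_in0 e : common_in e finset.set0 = [set: V].
Proof. by apply/setP=> w; rewrite !inE; apply/forall_inP=> a; rewrite inE. Qed.

Lemma common_in_setU1 e A v :
  common_in e (v |: A) = [set w in common_in e A | e w v].
Proof.
apply/setP=> w; rewrite [RHS]inE; apply/in_common/andP => [H|[/in_common H ev] a].
  split; last by apply: H; rewrite setU11.
  by apply/in_common=> a aA; apply: H; rewrite setU1r.
by case/setU1P=> [->|/H].
Qed.

Lemma tournament_irrefl e u : tournament e -> e u u = false.
Proof. by move=> /(_ u u); rewrite eqxx. Qed.

Lemma tournament_asym e u v : tournament e -> e u v -> e v u = false.
Proof. by move=> te; rewrite te => /andP[_ /negbTE]. Qed.

(** The in-degrees and the out-degrees inside W have the same sum, and the two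
    degrees of a vertex add up to #|W| - 1, so they average (#|W| - 1) / 2. *)
Lemma small_indegree e W : tournament e -> W != finset.set0 ->
  exists2 v, v \in W & (#|[set w in W | e w v]|.*2 < #|W|)%N.
Proof.
move=> te W0; apply/exists_inP; apply: contraT; rewrite negb_exists_in => /forall_inP H.
have deg v : v \in W ->
    (#|[set w in W | e w v]| + #|[set w in W | e v w]|).+1 = #|W|.
  move=> vW; rewrite [RHS](cardsD1 v W) vW add1n; congr _.+1.
  have disj : [set w in W | e w v] :&: [set w in W | e v w] = finset.set0.
    by apply/setP=> w; rewrite !inE [e v w]te; case: (e w v); rewrite /= ?andbF.
  rewrite -cardsUI disj cards0 addn0; apply: eq_card => w.
  rewrite !inE [e v w]te; case: (w \in W); rewrite ?andbF //= eq_sym.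
  by case: eqVneq => [->|_] /=; rewrite ?tournament_irrefl //; case: (e w v).
(* Both sides count the arcs inside W. *)
have sumC : \sum_(v in W) #|[set w in W | e w v]| =
            \sum_(v in W) #|[set w in W | e v w]|.
  have E (f : rel V) : \sum_(v in W) #|[set w in W | f w v]| =
      \sum_(v in W) \sum_(w in W) (f w v : nat).
    by apply: eq_bigr => v _; rewrite -sum1dep_card big_mkcondr.
  by rewrite E exchange_big -(E (fun w v => e v w)).
have : \sum_(v in W) #|[set w in W | e w v]|.*2 < \sum_(v in W) #|W|.
  rewrite (eq_bigr (fun v => #|[set w in W | e w v]| + #|[set w in W | e w v]|));
    last by move=> v _; rewrite addnn.
  rewrite big_split /= [X in (_ + X < _)]sumC -big_split /=.
  rewrite -[X in _ < X](eq_bigr _ deg).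
  under [X in _ < X]eq_bigr do rewrite -addn1.
  rewrite [X in _ < X]big_split /= sum1_card -[X in X < _]addn0 ltn_add2l.
  by rewrite card_gt0.
rewrite ltnNge => /negP[].
by apply: leq_sum => v /H; rewrite -leqNgt.
Qed.

(** If v dominated all common in-neighbours of A, then a common in-neighbour w of
    A and v would be dominated by v while dominating v. So the set of common
    in-neighbours of A is too large for the property to apply to it. *)
Lemma schutte_common_big e k A : tournament e -> schutte e k ->
  #|A| < k -> k < #|common_in e A|.
Proof.
move=> te sch Ak; rewrite ltnNge; apply/negP => /sch/set0Pn[v /in_common vN].
have /sch/set0Pn[w] : #|v |: A| <= k.
  by apply: leq_trans Ak; rewrite cardsU1; case: (v \notin A).
rewrite common_in_setU1 inE => /andP[/vN vw wv].
by rewrite (tournament_asym te vw) in wv.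
Qed.

(** Adding to A a vertex v that few common in-neighbours of A dominate more than
    halves their number; j counts how many times this can be done before A
    reaches size k - 1. *)
Lemma schutte_common_exp e k j A : tournament e -> schutte e k ->
  #|A| + j < k -> 2 ^ j * k.+2 <= #|common_in e A|.+1.
Proof.
move=> te sch; elim: j A => [|j IH] A.
  by rewrite addn0 mul1n; apply: schutte_common_big.
move=> Ak; have : common_in e A != finset.set0.
  by apply: sch; apply: leq_trans (leq_addr j.+1 _) (ltnW Ak).
case/(small_indegree te) => v vN small.
have /IH : #|v |: A| + j < k.
  by rewrite cardsU1; case: (v \notin A); lia.
by rewrite common_in_setU1 expnS; lia.
Qed.

(** The bound of E. and G. Szekeres, from the empty set, whose common
    in-neighbours are all the vertices. *)
Lemma schutte_order e k : 0 < k -> tournament e -> schutte e k ->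
  2 ^ k.-1 * k.+2 <= #|V|.+1.
Proof.
move=> k0 te sch; rewrite -cardsT -(common_in0 e).
by apply: schutte_common_exp => //; rewrite cards0; lia.
Qed.

End Tournaments.

(** * Orientations of the complete graph *)

Lemma orientation_tournament n (D : digraph 'I_n) :
  orientation (complete_graph n) D -> tournament (fun u v => (u, v) \in D).
Proof.
move=> /forallP H u v; have /forallP/(_ v) := H u.
rewrite /=; case: eqVneq => /= [_ /negbTE //|_].
by case: (_ \in D); case: (_ \in D).
Qed.

Definition arcs (V : finType) (e : rel V) : digraph V :=
  [set p | e p.1 p.2].

Lemma tournament_orientation n (e : rel 'I_n) :
  tournament e -> orientation (complete_graph n) (arcs e).
Proof.
move=> te; apply/forallP=> u; apply/forallP => v; rewrite !inE /= [e u v]te.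
by case: eqVneq => //=; case: (e v u).
Qed.

Lemma gamma_t_le (V : finType) (D : digraph V) S :
  total_dominating D S -> gamma_t D <= #|S|.
Proof.
move=> domS; rewrite /gamma_t; case: arg_minnP => [|T _]; last exact.
apply/forallP=> v; have /forallP/(_ v)/existsP[u /andP[_ uv]] := domS.
by apply/existsP; exists u; rewrite inE.
Qed.

Lemma indegree_gt0P (V : finType) (D : digraph V) v :
  reflect (exists u, (u, v) \in D) (0 < indegree D v).
Proof.
rewrite /indegree card_gt0; apply: (iffP (set0Pn _)) => -[u].
  by rewrite inE; exists u.
by exists u; rewrite inE.
Qed.

Lemma gamma_t_attained n (D : digraph 'I_n) :
  valid_orientation (complete_graph n) D ->
  exists2 S, total_dominating D S & #|S| = gamma_t D.
Proof.
case/andP=> _ /forallP ind; rewrite /gamma_t; case: arg_minnP => [|S domS _].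
  apply/forallP=> v; apply/existsP; have /indegree_gt0P[u uv] := ind v.
  by exists u; rewrite inE.
by exists S.
Qed.

(** A vertex outside S fails to dominate some vertex of S, hence has an
    in-neighbour in S. Inside S only a vertex that dominates the rest of S can
    lack one; there is at most one such vertex, and it is covered by adding to S
    one of its in-neighbours, which validity provides. *)
Lemma gamma_t_le_undominated n (D : digraph 'I_n) S :
  valid_orientation (complete_graph n) D ->
  common_in (fun u v => (u, v) \in D) S = finset.set0 -> gamma_t D <= #|S|.+1.
Proof.
case/andP=> /orientation_tournament te /forallP ind noS.
pose src := [set v in S | [forall u in S, (u, v) \notin D]].
have outS v : v \notin S -> exists2 u, u \in S & (u, v) \in D.
  move=> vS; have : v \notin common_in (fun u v => (u, v) \in D) S.
    by rewrite noS inE.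
  rewrite inE negb_forall_in => /exists_inP[u uS vu]; exists u => //.
  rewrite te vu andbT; apply: contraNneq vS => <- //.
have inS v : v \in S -> v \notin src -> exists2 u, u \in S & (u, v) \in D.
  move=> vS; rewrite inE vS negb_forall_in => /exists_inP[u uS].
  by rewrite negbK; exists u.
case: (set_0Vmem src) => [src0|[x xsrc]].
  apply: leq_trans (leqnSn _); apply: gamma_t_le; apply/forallP=> v.
  have [u uS uv] : exists2 u, u \in S & (u, v) \in D.
    by case: (boolP (v \in S)) => [/inS|/outS //]; apply; rewrite src0 inE.
  by apply/existsP; exists u; rewrite uS.
have /indegree_gt0P[y yx] := ind x.
apply: leq_trans (_ : #|y |: S| <= _); last first.
  by rewrite cardsU1; case: (y \notin S).
apply: gamma_t_le; apply/forallP=> v; apply/existsP.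
have [->|vx] := eqVneq v x; first by exists y; rewrite setU11.
have [u uS uv] : exists2 u, u \in S & (u, v) \in D.
  case: (boolP (v \in S)) => [vS|/outS //]; apply: inS => //.
  apply/negP; rewrite inE vS => /forall_inP vsrc.
  move: xsrc; rewrite inE => /andP[xS /forall_inP xsrc].
  by have := te v x; rewrite vx (negbTE (vsrc x xS)) (negbTE (xsrc v vS)).
by exists u; rewrite setU1r.
Qed.

Lemma DOM_t_complete_le n k : 0 < k -> n.+1 < 2 ^ k.-1 * k.+2 ->
  DOM_t (complete_graph n) <= k.+1.
Proof.
move=> k0 nk; apply/bigmax_leqP => D vD.
have [te _] := andP vD; move/orientation_tournament in te.
have /existsP[S /andP[Sk /eqP noS]] : [exists S : {set 'I_n}, (#|S| <= k) &&
    (common_in (fun u v => (u, v) \in D) S == finset.set0)].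
  apply: contraT; rewrite negb_exists => /forallP H.
  have sch : schutte (fun u v => (u, v) \in D) k.
    by move=> S Sk; have := H S; rewrite Sk.
  by have := schutte_order k0 te sch; rewrite card_ord leqNgt nk.
by apply: leq_trans (gamma_t_le_undominated vD noS) _.
Qed.

Lemma lt_DOM_t_complete n (D : digraph 'I_n) k :
    valid_orientation (complete_graph n) D ->
    (forall S : {set 'I_n}, #|S| <= k -> ~~ total_dominating D S) ->
  k < DOM_t (complete_graph n).
Proof.
move=> vD nodom; apply: leq_trans (leq_bigmax_cond _ vD).
have [S domS <-] := gamma_t_attained vD.
by rewrite ltnNge; apply/negP => /nodom; rewrite domS.
Qed.

(** Going backwards along arcs inside S from any vertex gives x, y, z in S with
    z -> y -> x; a tournament has no 2-cycle, so z differs from x. *)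
Lemma total_dominating_gt2 n (D : digraph 'I_n) S : 0 < n ->
  orientation (complete_graph n) D -> total_dominating D S -> 2 < #|S|.
Proof.
move=> n0 /orientation_tournament te /forallP dom.
have [x /andP[xS _]] := existsP (dom (Ordinal n0)).
have [y /andP[yS yx]] := existsP (dom x).
have [z /andP[zS zy]] := existsP (dom y).
have xy := tournament_asym te yx; have irr u := tournament_irrefl u te.
apply/card_gt2P; exists x, y, z; do 2 split=> //.
- by apply: contraTneq yx => ->; rewrite irr.
- by apply: contraTneq zy => ->; rewrite irr.
- by apply: contraFneq xy => <-.
Qed.

Lemma DOM_t_complete_ge3 n : 2 < n -> 2 < DOM_t (complete_graph n).
Proof.
case: n => [|[|[|m]]] // _.
(* The transitive tournament with the arc from first to last vertex reversed. *)
pose e (u v : 'I_m.+3) := [|| (u == 0 :> nat) && (0 < v < m.+2),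
  (v == 0 :> nat) && (u == m.+2 :> nat) | 0 < u < v].
have te : tournament e.
  move=> u v; rewrite /e -val_eqE /=; have := ltn_ord u; have := ltn_ord v.
  by move: (nat_of_ord u) (nat_of_ord v) => a b; lia.
have vD : valid_orientation (complete_graph m.+3) (arcs e).
  apply/andP; split; first exact: tournament_orientation.
  apply/forallP=> v; apply/indegree_gt0P; have vn := ltn_ord v.
  exists (inord (if v == 0 :> nat then m.+2 else (v == m.+2 :> nat))).
  rewrite inE /e /= !inordK; last first.
    by move: (nat_of_ord v) => a; case: (a =P 0) => // _; case: (a =P m.+2).
  by move: (nat_of_ord v) vn => a; case: (a =P 0); case: (a =P m.+2); lia.
apply: (lt_DOM_t_complete vD) => S; rewrite leqNgt; apply: contra.
by case/andP: vD => oD _; apply: total_dominating_gt2.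
Qed.

(** * Random tournaments *)

Section RandomTournament.
Variable n : nat.
Local Notation V := 'I_n.
Local Notation coins := {ffun V -> {ffun V -> bool}}.
Implicit Types (f : coins) (S : {set V}).

(** An arc is decided by two coins, one in the row of each endpoint, and by the
    order of the endpoints, which breaks the symmetry. Once the rows of S are
    fixed, the arcs from v to S thus depend, bijectively, on row v only, which
    makes them independent of the arcs of other vertices. *)
Definition coin_rel f : rel V :=
  fun u v => (u != v) && (f u v (+) f v u (+) (u < v)).

Lemma coin_tournament f : tournament (coin_rel f).
Proof.
move=> u v; rewrite /coin_rel [v == u]eq_sym; case: eqVneq => //= uv.
have -> : (u < v) = ~~ (v < u) by move: uv; rewrite -val_eqE /=; lia.
by rewrite addbN addbC [f u v (+) _]addbC addbC.
Qed.

Definition outdominated f S :=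
  [exists (v | v \notin S), [forall s in S, coin_rel f v s]].

(** The change of variables that puts the arcs from outside S into S in place of
    the coins that decide them. *)
Definition recoin S f : coins :=
  [ffun v => [ffun s => if (v \notin S) && (s \in S) then coin_rel f v s
                        else f v s]].

(** Only coins f v s with v outside S and s in S change, and the change is the
    exclusive or with coins f s v that are kept; so this is an involution. *)
Lemma recoin_inj S : injective (recoin S).
Proof.
suff K : cancel (recoin S) (recoin S) by apply: can_inj K.
move=> f; apply/ffunP=> v; apply/ffunP=> s; rewrite !ffunE /coin_rel !ffunE.
case: (boolP (v \in S)) => [vS|vS] //=; case: (boolP (s \in S)) => [sS|sS] //=.
have vs : v != s by apply: contraNneq vS => ->.
rewrite /coin_rel vs /=.
by case: (f v s); case: (f s v); case: (v < s).
Qed.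

Definition bad_rows S (v : V) : pred {ffun V -> bool} :=
  fun r => (v \in S) || ~~ [forall s in S, r s].

Lemma recoin_bad S f : ~~ outdominated f S -> recoin S f \in family (bad_rows S).
Proof.
rewrite negb_exists_in => /forall_inP H; apply/familyP => v.
rewrite unfold_in /bad_rows; case: (boolP (v \in S)) => //= vS.
apply: contra (H v vS) => /forall_inP all1; apply/forall_inP => s sS.
by have := all1 s sS; rewrite !ffunE vS sS.
Qed.

Lemma card_notin S : #|[pred i | i \notin S]| = n - #|S|.
Proof. by rewrite -[LHS](addKn #|S|) cardC card_ord. Qed.

Lemma card_all_true S :
  #|[pred r : {ffun V -> bool} | [forall s in S, r s]]| = 2 ^ (n - #|S|).
Proof.
rewrite (eq_card (B := family (fun s => if s \in S then pred1 true else predT))).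
  rewrite card_family foldrE big_map big_enum /=.
  rewrite (bigID (mem S)) /= big1 => [|s sS]; last by rewrite sS card1.
  rewrite mul1n (eq_bigr (fun=> 2)) => [|s /negbTE ->]; last by rewrite card_bool.
  rewrite prod_nat_const; congr (_ ^ _).
  exact: card_notin.
move=> r; rewrite !inE; apply/forall_inP/familyP => H s.
  by case: ifP => // /H ->.
by move=> sS; have := H s; rewrite sS inE => /eqP.
Qed.

(** The rows are constrained independently: 2^n choices in S, and outside S all
    but the 2^(n-#|S|) rows that are true on S. *)
Lemma card_bad S : #|family (bad_rows S)| =
  (2 ^ n) ^ #|S| * (2 ^ (n - #|S|) * (2 ^ #|S| - 1)) ^ (n - #|S|).
Proof.
rewrite card_family foldrE big_map big_enum /=.
rewrite (bigID (mem S)) /=; congr (_ * _).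
  rewrite (eq_bigr (fun=> 2 ^ n)) ?prod_nat_const // => s sS.
  rewrite (eq_card (B := predT)) ?card_ffun ?card_bool ?card_ord // => r.
  by rewrite unfold_in /bad_rows /= sS.
rewrite (eq_bigr (fun=> 2 ^ n - 2 ^ (n - #|S|))) => [|s sS]; last first.
  rewrite -card_all_true (_ : 2 ^ n = #|{ffun V -> bool}|); last first.
    by rewrite card_ffun card_bool card_ord.
  rewrite -(cardC [pred r : {ffun V -> bool} | [forall s in S, r s]]) addKn.
  by apply: eq_card => r; rewrite !inE unfold_in /bad_rows (negbTE sS).
rewrite prod_nat_const; congr (_ ^ _).
  rewrite mulnBr muln1 -expnD subnK //.
  by rewrite -[X in _ <= X]card_ord; apply: max_card.
exact: card_notin.
Qed.

(** The union bound over all k-sets. *)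
Lemma exists_outdominated k : k <= n ->
  'C(n, k) * (2 ^ k - 1) ^ (n - k) < (2 ^ k) ^ (n - k) ->
  exists f, forall S, #|S| = k -> outdominated f S.
Proof.
move=> kn small.
have [/existsP[f /forallP Hf]|none] :=
    boolP [exists f, forall S : {set V}, (#|S| == k) ==> outdominated f S].
  by exists f => S Sk; have := Hf S; rewrite Sk eqxx.
exfalso; move: small; apply/negP; rewrite -leqNgt.
(* Multiplying by c0 turns the hypothesis into a comparison with the number of
   outcomes. *)
have c0 : 0 < (2 ^ n) ^ k * (2 ^ (n - k)) ^ (n - k).
  by rewrite muln_gt0 !expn_gt0.
rewrite -(leq_pmul2l c0).
have -> : (2 ^ n) ^ k * (2 ^ (n - k)) ^ (n - k) * (2 ^ k) ^ (n - k) = #|{: coins}|.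
  rewrite -mulnA -expnMn -expnD subnK // -expnD subnKC //.
  by rewrite !card_ffun card_bool card_ord.
pose bad S := [set f | ~~ outdominated f S].
have cover : [set: coins] \subset \bigcup_(S in [set S : {set V} | #|S| == k]) bad S.
  apply/fintype.subsetP=> f _; move: none; rewrite negb_exists => /forallP/(_ f).
  rewrite negb_forall => /existsP[S]; rewrite negb_imply => /andP[Sk nd].
  by apply/bigcupP; exists S; rewrite inE.
rewrite -cardsT; apply: leq_trans (subset_leq_card cover) _.
apply: leq_trans (card_big_setU _ _ _) _.
apply: leq_trans (_ : \sum_(S in [set S : {set V} | #|S| == k])
    (2 ^ n) ^ k * (2 ^ (n - k) * (2 ^ k - 1)) ^ (n - k) <= _).
  apply: leq_sum => S; rewrite inE => /eqP <-; rewrite -card_bad.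
  rewrite -(card_imset (bad S) (@recoin_inj S)); apply/subset_leq_card.
  apply/fintype.subsetP=> _ /imsetP[f + ->]; rewrite inE.
  exact: recoin_bad.
by rewrite sum_nat_const card_draws card_ord expnMn; lia.
Qed.

End RandomTournament.

Lemma exists_superset_card (T : finType) (S : {set T}) k :
  #|S| <= k <= #|T| -> exists2 S' : {set T}, S \subset S' & #|S'| = k.
Proof.
elim: k => [|k IH]; first by rewrite leqn0 => /andP[/eqP]; exists S.
case/andP; rewrite leq_eqVlt => /predU1P[<-|Sk] kT; first by exists S.
have [|S' SS' S'k] := IH; first by rewrite -ltnS Sk ltnW.
have /card_gt0P[x] : 0 < #|~: S'| by rewrite cardsCs finset.setCK S'k subn_gt0.
rewrite inE => xS'; exists (x |: S'); last by rewrite cardsU1 xS' S'k.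
by apply: fintype.subset_trans SS' _; apply: finset.subsetUr.
Qed.

(** Validity comes for free: a common in-neighbour of a set containing x is an
    in-neighbour of x. *)
Lemma lt_DOM_t_complete_bin n k : 0 < k <= n ->
  'C(n, k) * (2 ^ k - 1) ^ (n - k) < (2 ^ k) ^ (n - k) ->
  k < DOM_t (complete_graph n).
Proof.
case/andP=> k0 kn /(exists_outdominated kn)[f fout].
have te := coin_tournament f.
have out (S : {set 'I_n}) : #|S| <= k ->
    exists v, {in S, forall s, coin_rel f v s}.
  move=> Sk; have [|S' /fintype.subsetP SS' /fout] :=
    exists_superset_card (S := S) (k := k); first by rewrite Sk card_ord.
  by case/exists_inP=> v _ /forall_inP vS'; exists v => s /SS'/vS'.
apply: (@lt_DOM_t_complete _ (arcs (coin_rel f))) => [|S /out[v vS]].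
  rewrite /valid_orientation tournament_orientation //.
  apply/forallP=> x; apply/indegree_gt0P.
  have [|v vx] := out [set x]; first by rewrite cards1.
  by exists v; rewrite inE vx ?finset.set11.
apply/forallPn; exists v; rewrite negb_exists; apply/forallP=> u.
rewrite negb_and inE /=; case: (boolP (u \in S)) => //= /vS.
by move/(tournament_asym te)->.
Qed.

Lemma bin_leq_expn n k : 'C(n, k) <= n ^ k.
Proof.
apply: leq_trans (_ : n ^_ k <= _).
  by rewrite -bin_ffact leq_pmulr // fact_gt0.
elim: k => [|k IH]; first by rewrite ffactn0.
by rewrite ffactnSr expnSr leq_mul // leq_subr.
Qed.

(** * Logarithmic estimates *)

Import Order.TTheory GRing.Theory Num.Theory.
Local Open Scope ring_scope.

Section Log2.
Variable R : realType.
Implicit Types x : R.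

Lemma ln2_gt0 : 0 < ln 2 :> R.
Proof. by rewrite ln_gt0 // ltr1n. Qed.

Lemma ln2_le1 : ln 2 <= 1 :> R.
Proof. by have := @le_ln1Dx R 1; rewrite -natr1 => ->//; lra. Qed.

Lemma ln2_ge_half : 2^-1 <= ln 2 :> R.
Proof.
have := @le_ln1Dx R (- 2^-1); rewrite (_ : 1 + - 2^-1 = 2^-1 :> R); last by lra.
by rewrite lnV ?posrE ?ltr0n // lerN2; apply; lra.
Qed.

(** The bound ln y <= y at y = x / 4, with 1 / 2 <= ln 2. *)
Lemma log2_le_half x : 0 < x -> log2 x <= x / 2 + 2.
Proof.
move=> x0; rewrite /log2 ler_pdivrMr ?ln2_gt0 //.
have -> : ln x = ln (x / 4) + 2 * ln 2.
  have -> : x = x / 4 * (2 ^+ 2) by field.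
  rewrite lnM ?posrE ?divr_gt0 ?exprn_gt0 //; try lra.
  by rewrite lnXn // mulr_natl; congr (ln _ + _); field.
have := @ln_sublinear _ (x / 4); have := ln2_ge_half; nra.
Qed.

Lemma log2_ge1 x : 2 <= x -> 1 <= log2 x.
Proof.
by move=> x2; rewrite /log2 ler_pdivlMr ?ln2_gt0 // mul1r ler_ln ?posrE; lra.
Qed.

Lemma expR_log2 x : 0 < x -> expR (log2 x * ln 2) = x.
Proof. by move=> x0; rewrite /log2 divfK ?gt_eqF ?ln2_gt0 // lnK. Qed.

Lemma expRn_ln2 k : expR (k%:R * ln 2) = 2 ^+ k :> R.
Proof. by rewrite expRM_natl lnK // posrE ltr0n. Qed.

End Log2.

Lemma DOM_t_complete_upper (R : realType) n : (3 <= n)%N ->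
  (DOM_t (complete_graph n))%:R
    <= log2 (n%:R : R) - log2 (log2 (n%:R : R)) + 4.
Proof.
move=> n3; have n3R : 3 <= n%:R :> R by rewrite ler_nat.
have n0 : 0 < n%:R :> R by lra.
set L := log2 n%:R.
have L1 : 1 <= L by apply: log2_ge1; lra.
have L0 : 0 < L by lra.
have lL := log2_le_half L0.
(* The number k below is the largest with k + 1 <= L - log2 L + 4. *)
set y := L - log2 L + 3.
have y1 : 1 <= y by rewrite /y; lra.
have /andP[ky yk] := truncn_itv (le_trans ler01 y1).
set k := Num.truncn y in ky yk.
have k0 : (0 < k)%N by rewrite -(ltr0n R); move: yk; rewrite -natr1; lra.
rewrite (_ : _ + 4 = y + 1); last by rewrite /y; lra.
apply: le_trans (_ : k%:R + 1 <= _); last by lra.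
rewrite natr1 ler_nat; apply: DOM_t_complete_le => //.
have yk2 : y < k.-1%:R + 2 by move: yk; rewrite -{1}(prednK k0) -!natr1; lra.
rewrite -(ltr_nat R) natrM natrX -expRn_ln2 -[n.+1]addn1 -[k.+2]addn2 2!natrD.
have big : 2 * n%:R / L <= expR (k.-1%:R * ln 2).
  rewrite -(expR_log2 (x := 2 * n%:R / L)); last by apply: divr_gt0 => //; lra.
  rewrite ler_expR ler_wpM2r ?ltW ?ln2_gt0 //.
  rewrite /log2 ln_div ?posrE //; last by lra.
  rewrite lnM ?posrE //.
  rewrite 2!mulrDl mulNr divff ?gt_eqF ?ln2_gt0 // -/(log2 _) -/(log2 _) -/L.
  by move: yk2; rewrite /y; lra.
apply: lt_le_trans (_ : 2 * n%:R / L * (k%:R + 2) <= _); last first.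
  by rewrite ler_wpM2r // addr_ge0 // ler0n.
rewrite mulrAC ltr_pdivlMr //.
(* 2n (k + 2) >= 2n (L / 2 + 2) = nL + 4n, and 4n exceeds L. *)
have Ln : L < 2 * n%:R.
  rewrite /L /log2 ltr_pdivrMr ?ln2_gt0 //.
  by have := ln_sublinear n0; have := ln2_ge_half R; nra.
have : L / 2 + 2 < k%:R + 2 by move: yk; rewrite -natr1 /y; lra.
nra.
Qed.

Lemma DOM_t_complete_lower (R : realType) n : (3 <= n)%N ->
  log2 (n%:R : R) - 2 * log2 (log2 (n%:R : R))
    <= (DOM_t (complete_graph n))%:R.
Proof.
move=> n3; have n3R : 3 <= n%:R :> R by rewrite ler_nat.
have m3 := DOM_t_complete_ge3 n3.
set m := DOM_t (complete_graph n) in m3 *.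
set L := log2 n%:R; rewrite leNgt; apply/negP => mL.
have m3R : 3 <= m%:R :> R by rewrite ler_nat.
have L1 : 1 <= L by apply: log2_ge1; lra.
have lL0 : 0 <= log2 L by rewrite divr_ge0 // ln_ge0 // ler1n.
have lL1 : 1 <= log2 L by apply: log2_ge1; lra.
have lnE : ln n%:R = L * ln 2 by rewrite /L /log2 divfK // gt_eqF // ln2_gt0.
pose q : R := 2 ^+ m.
have q1 : 1 <= q by rewrite exprn_ege1 // ler1n.
have qL : q * L ^+ 2 < n%:R.
  rewrite /q -expRn_ln2 -{1}(expR_log2 (x := L)); last by lra.
  rewrite -(expR_log2 (x := n%:R)); last by lra.
  rewrite -expRM_natl -expRD ltr_expR -/L.
  by rewrite mulrA -mulrDl ltr_pM2r ?ln2_gt0 //; lra.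
have LqL : L <= q * L ^+ 2.
  by rewrite -[leLHS]mul1r ler_pM //; [lra | rewrite ler_eXnr].
have mn : (m < n)%N by rewrite -(ltr_nat R); lra.
have /negP := ltnn m; apply.
apply: lt_DOM_t_complete_bin; first by rewrite (ltnW mn) (ltnW (ltnW m3)).
apply: leq_ltn_trans (leq_mul (bin_leq_expn n m) (leqnn _)) _.
rewrite -(ltr_nat R) natrM !natrX natrB ?expn_gt0 // natrX -/q.
clearbody q m L.
have qq : q - 1 <= q * expR (- q^-1).
  have -> : q - 1 = q * (1 - q^-1) by field; lra.
  by rewrite ler_wpM2l ?expR_ge1Dx //; lra.
apply: le_lt_trans (_ : n%:R ^+ m * (q * expR (- q^-1)) ^+ (n - m) < _).
  rewrite ler_wpM2l ?exprn_ge0 ?ler0n //.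
  by apply: lerXn2r; rewrite ?nnegrE ?mulr_ge0 ?expR_ge0 //; lra.
rewrite exprMn mulrCA gtr_pMr ?exprn_gt0 //; last by lra.
rewrite -{1}(lnK (x := n%:R)) ?posrE; last by lra.
rewrite -!expRM_natl -expRD expR_lt1 natrB ?(ltnW mn) //.
rewrite mulrN subr_lt0 ltr_pdivlMr; last by lra.
rewrite lnE.
have l1 := ln2_le1 R; have l0 := ln2_gt0 R.
(* It remains that m (ln n) q < n - m. From m < L - 2 and ln 2 <= 1 the left side
   is at most q L^2 - 2 q L < n - 2 q L, and q L >= L > m. *)
have low : m%:R * (L * ln 2) * q <= (L - 2) * L * q.
  rewrite ler_wpM2r //; first by lra.
  apply: ler_pM; [by lra | by apply: mulr_ge0; lra | by lra |].
  by rewrite ler_piMr //; lra.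
have Lq : L <= L * q by rewrite ler_peMr //; lra.
have E : (L - 2) * L * q = q * L ^+ 2 - 2 * (L * q) by ring.
lra.
Qed.

Theorem theorem3p3 (R : realType) (n : nat) (hn : (3 <= n)%N) :
  log2 (n%:R : R) - 2 * log2 (log2 (n%:R : R))
    <= (DOM_t (complete_graph n))%:R
    <= log2 (n%:R : R) - log2 (log2 (n%:R : R)) + 4.
Proof. by rewrite DOM_t_complete_lower // DOM_t_complete_upper. Qed.
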